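(* Let $\mu$ be a probability measure on $\mathbb{Z}$. Then every point-wise limit of non-negative harmonic functions on $\mathbb{Z}$ relative to $\mu$ is harmonic relative to $\mu$; that is, if $(f_n)$ is a sequence of functions $\mathbb{Z} \to \mathbb{R}_+$ harmonic relative to $\mu$ and $f : \mathbb{Z} \to \mathbb{R}_+$ satisfies $f_n(x) \to f(x)$ for every $x \in \mathbb{Z}$, then $f$ is harmonic relative to $\mu$.
   Context: Here $\mathbb{R}_+ = [0,+\infty)$. Given a probability measure $\mu$ on $\mathbb{Z}$, a function $f : \mathbb{Z} \to \mathbb{R}_+$ is called harmonic relative to $\mu$ if $f(x_0) = \int_{\mathbb{Z}} f(x_0 + x)\, d\mu(x)$ for every $x_0 \in \mathbb{Z}$. The integrals of non-negative functions take values in $[0,+\infty]$. *)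

(* Defs.v *)
From HB Require Import structures.
From mathcomp Require Import all_boot all_order all_algebra.
From mathcomp Require Import all_classical all_reals all_analysis.

Set Implicit Arguments.
Unset Strict Implicit.
Unset Printing Implicit Defensive.

Import Order.TTheory GRing.Theory Num.Theory.
Import numFieldNormedType.Exports.

Local Open Scope classical_set_scope.
Local Open Scope ring_scope.

HB.instance Definition _ := isPointed.Build int 0.

(* The library equips unit, bool and nat, but not int, with the discrete
   sigma-algebra; the default display is the one it uses for those types. *)
HB.instance Definition _ := @isMeasurable.Build default_measure_display
  int discrete_measurable discrete_measurable0
  discrete_measurableC discrete_measurableU.

(* The integral is \bar R-valued, so the equation also asserts that it is
   finite.  Non-negativity of f is not included here: functions into
   [0, +oo[ are functions into R with an explicit sign hypothesis, under which
   the library's integral (positive part minus negative part) is the usual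
   integral of a non-negative function. *)
Definition harmonic_int (R : realType) (mu : probability int R)
    (f : int -> R) : Prop :=
  forall x0 : int, (f x0)%:E = (\int[mu]_(x in [set: int]) (f (x0 + x)%R)%:E)%E.

(* Main.v *)
Require Import Defs.
From HB Require Import structures.
From mathcomp Require Import all_boot all_order all_algebra.
From mathcomp Require Import all_classical all_reals all_analysis.
From mathcomp Require Import lra.

Set Implicit Arguments.
Unset Strict Implicit.
Unset Printing Implicit Defensive.

Import Order.TTheory GRing.Theory Num.Theory.
Import numFieldNormedType.Exports.

Local Open Scope classical_set_scope.
Local Open Scope ring_scope.

(** Pointwise limits of non-negative harmonic functions are superharmonic by
Fatou's lemma; equality can fail only if mass escapes to infinity under the
integral. The proof rules this out by dominated convergence. For [k] in the
support of [mu], let [growth k] be the supremum of [f k] over the non-negative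
harmonic functions [f] with [f 0 = 1]. It is finite because
[mu {k} * f (x + k) <= f x], and translation invariance gives the Harnack
inequality [f (x + k) <= growth k * f x] ([harmonic_step_le]). So a constant
multiple of [growth] dominates all the functions [f_n (x0 + .)], the sequence
[f_n x0] being bounded because it converges, and it remains to see that [growth]
is [mu]-integrable over the support ([integrable_growth]).

For this, let [f 0 = 1] and suppose that [f k] is close to [growth k]. The
defect [x |-> growth k * f x - f (x + k)] is again non-negative harmonic, and it
is small at [0], hence by the Harnack inequality small along all multiples of
[k]: so [f (k *+ n)] is close to [growth k ^+ n] ([harmonic_iter_ge]). If [y] is
another point of the support on the same side of [0], then [k] and [y] have a
common multiple by positive integers. Comparing the values of [f] there in two
ways shows that [growth] is exponential on each side of [0]
([growth_proportional_le]), and that [f y] is also close to [growth y]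
([near_growth_transfer]). One sequence of normalized harmonic functions thus
tends to [growth] at all points of the support on one side of [0]
simultaneously, and Fatou's lemma bounds the integral of [growth] over that side
by the common value [1] of these functions at [0] ([integral_growth_le1]). The point [0] itself is a third such side. *)

(** * Measures on the integers *)

Lemma measurable_int (D : set int) : measurable D.
Proof. by []. Qed.

Lemma limn_einf_le (R : realType) (u : (\bar R)^nat) (c : \bar R) :
  (forall n, u n <= c)%E -> (limn_einf u <= c)%E.
Proof.
move=> uc; rewrite limn_einf_lim; apply: lime_le; first exact: is_cvg_einfs.
apply: nearW => n; apply: le_trans (uc n).
by apply: ereal_inf_lbound; exists n => /=.
Qed.

(** The integers are discrete, so this is the support of [mu]. *)
Definition atoms (R : realType) (mu : probability int R) : set int :=
  [set k | mu [set k] != 0%E].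

Lemma atoms_mu_gt0 (R : realType) (mu : probability int R) (k : int) :
  atoms mu k -> 0 < fine (mu [set k]).
Proof.
move=> ak; apply: fine_gt0; rewrite lt0e ak measure_ge0/=.
by rewrite ltey_eq fin_num_measure.
Qed.

Lemma atomsC_null (R : realType) (mu : probability int R) :
  mu (~` atoms mu) = 0%E.
Proof.
apply/negligibleP; first exact: measurable_int.
pose F n := if unpickle n is Some k then [set k] `&` ~` atoms mu else set0.
apply: (@negligibleS _ _ _ mu (\bigcup_n F n)).
  by move=> k nk; exists (pickle k) => //; rewrite /F pickleK.
apply: negligible_bigcup => n; rewrite /F.
case: unpickle => [k|]; last exact: negligible_set0.
have [ak|nak] := pselect (atoms mu k).
  apply: (negligibleS _ (negligible_set0 mu)) => _ [-> nk]; exact: nk.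
apply: (@negligibleS _ _ _ mu [set k]); first by move=> ? [].
apply/negligibleP; first exact: measurable_int.
by apply/eqP; apply: contrapT => /negP.
Qed.

(** Restricting to the support turns almost-everywhere bounds into bounds at
every point of the domain of integration. *)
Lemma integral_atoms (R : realType) (mu : probability int R)
    (g : int -> \bar R) : (forall x, 0 <= g x)%E ->
  (\int[mu]_(x in [set: int]) g x = \int[mu]_(x in atoms mu) g x)%E.
Proof.
move=> g0; rewrite (@ge0_negligible_integral _ _ _ mu setT (~` atoms mu))//.
- by rewrite setTD setCK.
- exact: atomsC_null.
Qed.

(** * The cone of non-negative harmonic functions *)

Definition harmonic_ge0 (R : realType) (mu : probability int R)
    (f : int -> R) : Prop :=
  (forall x, 0 <= f x) /\ harmonic_int mu f.

Section growth.
Variables (R : realType) (mu : probability int R).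
Implicit Types (f : int -> R) (x k y : int).

Lemma harmonic_ge0_shift f k :
  harmonic_ge0 mu f -> harmonic_ge0 mu (fun x => f (x + k)).
Proof.
move=> [f0 hf]; split=> // x; rewrite hf; apply: eq_integral => z _.
by rewrite addrAC.
Qed.

Lemma harmonic_ge0Z (c : R) f :
  0 <= c -> harmonic_ge0 mu f -> harmonic_ge0 mu (fun x => c * f x).
Proof.
move=> c0 [f0 hf]; split=> [x|x]; first exact: mulr_ge0.
rewrite EFinM hf -ge0_integralZl//; last by move=> z _; rewrite lee_fin.
Qed.

Lemma harmonic_integrable f x :
  harmonic_ge0 mu f -> mu.-integrable setT (fun z => (f (x + z))%:E).
Proof.
move=> [f0 hf]; apply/integrableP; split=> //.
under eq_integral do rewrite gee0_abs ?lee_fin//.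
by rewrite -hf ltry.
Qed.

Lemma harmonic_ge0B f h : harmonic_ge0 mu f -> harmonic_ge0 mu h ->
  (forall x, h x <= f x) -> harmonic_ge0 mu (fun x => f x - h x).
Proof.
move=> Hf Hh hle; split=> [x|x]; first by rewrite subr_ge0.
rewrite EFinB (proj2 Hf x) (proj2 Hh x).
by rewrite -integralB//; exact: harmonic_integrable.
Qed.

(** The integral defining [f x] is at least its term at [k]. *)
Lemma harmonic_atom_le f x k :
  harmonic_ge0 mu f -> fine (mu [set k]) * f (x + k) <= f x.
Proof.
move=> [f0 hf]; rewrite -lee_fin EFinM fineK ?fin_num_measure// (hf x).
apply: (@le_trans _ _ (\int[mu]_(z in [set k]) (f (x + z))%:E)%E).
  rewrite (eq_integral (cst (f (x + k))%:E)) ?integral_cst//= 1?muleC//.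
  by move=> z; rewrite inE => ->.
by apply: ge0_subset_integral => // z _; rewrite lee_fin.
Qed.

(** * Growth of normalized harmonic functions *)

Definition normalized_harmonic : set (int -> R) :=
  [set f | harmonic_ge0 mu f /\ f 0 = 1].

(** The constants are harmonic, so the set is non-empty; it may be unbounded,
and the supremum a junk value, unless [k] is an atom. *)
Definition growth k : R := sup [set f k | f in normalized_harmonic].

Lemma normalized_harmonic1 : normalized_harmonic (cst 1).
Proof.
split=> //; split=> // x.
by rewrite /= integral_cst//= mul1e probability_setT.
Qed.

Lemma growth_has_sup k :
  atoms mu k -> has_sup [set f k | f in normalized_harmonic].
Proof.
move=> ak; split; first by exists 1, (cst 1) => //; exact: normalized_harmonic1.
exists (fine (mu [set k]))^-1 => _ [f [Hf f1] <-].
have := harmonic_atom_le 0 k Hf; rewrite add0r f1.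
by rewrite mulrC -ler_pdivlMr ?div1r// atoms_mu_gt0.
Qed.

Lemma growth_ge1 k : atoms mu k -> 1 <= growth k.
Proof.
move=> ak; apply: ub_le_sup; first by case: (growth_has_sup ak).
by exists (cst 1) => //; exact: normalized_harmonic1.
Qed.

Lemma growth_gt0 k : atoms mu k -> 0 < growth k.
Proof. by move=> /growth_ge1; exact: lt_le_trans. Qed.

(** Harnack inequality: after translation by [x] and division by [f x], the
function [f] competes in the supremum [growth k]. If [f x] vanishes, so does
[f (x + k)], by [harmonic_atom_le]. *)
Lemma harmonic_step_le f x k :
  harmonic_ge0 mu f -> atoms mu k -> f (x + k) <= growth k * f x.
Proof.
move=> Hf ak; have [f0 hf] := Hf.
have := f0 x; rewrite le_eqVlt => /predU1P[fx0|fx0].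
  have := harmonic_atom_le x k Hf.
  by rewrite -fx0 mulr0 pmulr_rle0// atoms_mu_gt0.
rewrite -ler_pdivrMr//; apply: ub_le_sup; first by case: (growth_has_sup ak).
exists (fun z => (f x)^-1 * f (z + x)); last by rewrite mulrC addrC.
split; last by rewrite add0r mulVf// gt_eqF.
apply: harmonic_ge0Z; first by rewrite invr_ge0 ltW.
exact: harmonic_ge0_shift.
Qed.

Lemma harmonic_iter_le f x k n : harmonic_ge0 mu f -> atoms mu k ->
  f (x + k *+ n) <= growth k ^+ n * f x.
Proof.
move=> Hf ak; elim: n => [|n IH]; first by rewrite addr0 mul1r.
rewrite mulrSr addrA (le_trans (harmonic_step_le _ Hf ak))//.
by rewrite exprS -mulrA ler_pM2l// growth_gt0.
Qed.

(** That the defect of the Harnack inequality lies in the same cone is what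
allows the inequality to be applied to the defect itself. *)
Lemma harmonic_defect f k : harmonic_ge0 mu f -> atoms mu k ->
  harmonic_ge0 mu (fun x => growth k * f x - f (x + k)).
Proof.
move=> Hf ak; apply: harmonic_ge0B.
- by apply: harmonic_ge0Z => //; rewrite ltW// growth_gt0.
- exact: harmonic_ge0_shift.
- by move=> x; exact: harmonic_step_le.
Qed.

(** The defect [d] at [0] bounds the defect at [k *+ i] by [growth k ^+ i * d].
Since [growth k >= 1], each of the [n] steps therefore costs at most
[growth k ^+ n * d] in the value at [k *+ n]. *)
Lemma harmonic_iter_ge f k n : normalized_harmonic f -> atoms mu k ->
  growth k ^+ n * (1 - n%:R * (growth k - f k)) <= f (k *+ n).
Proof.
move=> [Hf f1] ak; have Hd := harmonic_defect Hf ak.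
set d := growth k - f k.
have d0 : 0 <= d.
  by have := proj1 Hd 0; rewrite add0r f1 mulr1.
elim: n => [|n IH]; first by rewrite mul0r subr0 mulr1 mulr0n f1.
have := harmonic_iter_le 0 n Hd ak.
rewrite !add0r f1 mulr1 -/d -mulrSr lerBlDl -lerBlDr.
apply: le_trans.
have M1 := growth_ge1 ak; have M0 := growth_gt0 ak.
have Mn0 : 0 <= growth k ^+ n by rewrite exprn_ge0// ltW.
have : growth k ^+ n * d <= growth k ^+ n.+1 * d.
  by rewrite ler_wpM2r// exprS ler_peMl.
have : growth k * (growth k ^+ n * (1 - n%:R * d)) <= growth k * f (k *+ n).
  by rewrite ler_pM2l.
rewrite !exprS -natr1; move: (growth k ^+ n) => a; move: (growth k) => b.
by nra.
Qed.

Lemma near_growth k (e : R) : atoms mu k -> 0 < e ->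
  exists2 f, normalized_harmonic f & growth k - f k < e.
Proof.
move=> ak e0; have [_ [f Hf <-] lt] := sup_adherent e0 (growth_has_sup ak).
by exists f => //; rewrite ltrBlDr -ltrBlDl.
Qed.

(** Nearly extremal functions for [k] reach almost [growth k ^+ m] at the common
multiple [k *+ m], where the iterated Harnack inequality for [y] caps them by
[growth y ^+ n]. *)
Lemma growth_proportional_le k y m n : atoms mu k -> atoms mu y ->
  k *+ m = y *+ n -> growth k ^+ m <= growth y ^+ n.
Proof.
move=> ak ay kmyn; apply/ler_addgt0Pr => e e0.
set a := growth k ^+ m.
have a0 : 0 < a by rewrite exprn_gt0// growth_gt0.
(* The error allowed at [k] is amplified at [k *+ m] by [a * m]; the successor
   keeps the divisor positive when [m] is [0]. *)
have c0 : 0 < a * m.+1%:R by rewrite mulr_gt0.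
have [f Hf fk] := near_growth ak (divr_gt0 e0 c0).
have := harmonic_iter_ge m Hf ak; rewrite kmyn.
have := harmonic_iter_le 0 n (proj1 Hf) ay; rewrite add0r (proj2 Hf) mulr1.
move=> /[swap] /le_trans /[apply]; rewrite -/a mulrBr mulr1 lerBlDr.
move=> /le_trans; apply; rewrite lerD2l.
move: fk; rewrite ltr_pdivlMr// => /ltW; apply: le_trans.
rewrite mulrA mulrC ler_wpM2l//; last by rewrite ler_pM2l ?ler_nat.
have := proj1 (harmonic_defect (proj1 Hf) ak) 0.
by rewrite add0r (proj2 Hf) mulr1.
Qed.

(** At the common multiple, [f] is at least about
[growth k ^+ m = growth y ^+ n.+1], while [n] Harnack steps from [y] lead there
at the cost of [growth y ^+ n] only; the remaining factor must come from
[f y]. *)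
Lemma near_growth_transfer f k y m n : normalized_harmonic f ->
  atoms mu k -> atoms mu y -> k *+ m = y *+ n.+1 ->
  growth y * (1 - m%:R * (growth k - f k)) <= f y.
Proof.
move=> Hf ak ay kmyn.
have yn0 : 0 < growth y ^+ n by rewrite exprn_gt0// growth_gt0.
have := harmonic_iter_ge m Hf ak.
have -> : growth k ^+ m = growth y ^+ n.+1.
  by apply/le_anti; rewrite !growth_proportional_le.
rewrite kmyn exprSr -mulrA => low.
rewrite -(ler_pM2l yn0); apply: le_trans low _.
by rewrite mulrS harmonic_iter_le//; case: Hf.
Qed.

(** The hypothesis on [D] holds for integers of the same sign. It makes a sequence
that is extremal in the limit at one point of [D] extremal at all of them, so
that Fatou's lemma applies to it. *)
Lemma integral_growth_le1 (D : set int) : D `<=` atoms mu ->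
  (forall k y, D k -> D y -> exists m n, k *+ m = y *+ n.+1) ->
  (\int[mu]_(x in D) (growth x)%:E <= 1)%E.
Proof.
move=> Da Dprop.
have [->|/set0P[k Dk]] := eqVneq D set0; first by rewrite integral_set0.
have ak := Da _ Dk.
have /choice[f_ Hf_] n : exists f, normalized_harmonic f /\
    growth k - f k < n.+1%:R^-1.
  by have [|f] := @near_growth k n.+1%:R^-1 ak; [rewrite invr_gt0|exists f].
have f_cvg y : D y -> limn_einf (fun n => (f_ n y)%:E) = (growth y)%:E.
  move=> Dy; have ay := Da _ Dy; have [m [n kmyn]] := Dprop _ _ Dk Dy.
  apply: (cvg_limn_einf_sup _).1; apply: cvg_EFin; first exact: nearW.
  apply: (@squeeze_cvgr _ _ _ _
    (fun i => growth y * (1 - m%:R * i.+1%:R^-1)) (cst (growth y))).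
  - apply: nearW => i; have [Hf lt] := Hf_ i; apply/andP; split; last first.
      have := harmonic_step_le 0 (proj1 Hf) ay.
      by rewrite add0r (proj2 Hf) mulr1.
    apply: le_trans (near_growth_transfer Hf ak ay kmyn).
    rewrite ler_pM2l ?growth_gt0// lerD2l lerN2 ler_wpM2l//; exact: ltW.
  - rewrite -[X in _ --> X](_ : growth y * (1 - m%:R * 0) = _); last first.
      by rewrite mulr0 subr0 mulr1.
    apply: cvgMr; apply: cvgB; first exact: cvg_cst.
    by apply: cvgMr; exact: cvg_harmonic.
  - exact: cvg_cst.
rewrite -(eq_integral _ (fun y => limn_einf (fun n => (f_ n y)%:E)));
  last first.
  by move=> y; rewrite inE => /f_cvg.
apply: le_trans.
  by apply: fatou => // n x _; rewrite lee_fin; have [[[+ _] _] _] := Hf_ n.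
apply: limn_einf_le => n; have [[[f0 hf] f1] _] := Hf_ n.
rewrite -f1 hf; under [leRHS]eq_integral do rewrite add0r.
by apply: ge0_subset_integral => // x _; rewrite lee_fin.
Qed.

Lemma integrable_growth : mu.-integrable (atoms mu) (EFin \o growth).
Proof.
apply/integrableP; split=> //.
have -> : atoms mu = (atoms mu `&` [set x | 0 < x]) `|`
    ((atoms mu `&` [set x | x < 0]) `|` (atoms mu `&` [set 0])).
  rewrite -!setIUr; apply/esym/setIidPl => x _ /=.
  by have [x0|x0|->] := ltgtP 0 x; [left|right; left|right; right].
rewrite ge0_integral_setU//; last first.
  apply/disj_setPLR => x [_ /= x0] [[_ /=]|[_ /=]] x0'.
    by move: (lt_trans x0 x0'); rewrite ltxx.
  by move: x0; rewrite x0' ltxx.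
rewrite ge0_integral_setU//; last first.
  by apply/disj_setPLR => x [_ /= x0] [_ /= x0']; move: x0; rewrite x0' ltxx.
have le1 (P : set int) :
    (forall k y, P k -> P y -> exists m n, k *+ m = y *+ n.+1) ->
    (\int[mu]_(x in atoms mu `&` P) `|(EFin \o growth) x| < +oo)%E.
  move=> HP; rewrite (eq_integral (fun x => (growth x)%:E)); last first.
    move=> x; rewrite inE => -[ax _] /=.
    by rewrite ger0_norm// ltW// growth_gt0.
  apply: le_lt_trans (ltry 1); apply: integral_growth_le1 => // k y [_ ?] [_ ?].
  exact: HP.
rewrite lte_add_pinfty//; [|rewrite lte_add_pinfty//]; apply: le1 => k y /=.
- case: k y => [[|k]|k] [y|y]//= _ _; exists y, k.
  by rewrite -[LHS]mulr_natr -[RHS]mulr_natr !natz mulrC.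
- case: k y => [k|k] [y|y]//= _ _; exists y.+1, k.
  by rewrite -[LHS]mulr_natr -[RHS]mulr_natr !natz !NegzE !mulNr mulrC.
- by move=> -> ->; exists 0, 0%N; rewrite !mul0rn.
Qed.

End growth.

(** * Closedness under pointwise limits *)

Theorem corollary1 (R : realType) (mu : probability int R)
    (f_ : nat -> int -> R) (f : int -> R)
    (f_ge0 : forall (n : nat) (x : int), 0 <= f_ n x)
    (f_harmonic : forall n : nat, harmonic_int mu (f_ n))
    (fge0 : forall x : int, 0 <= f x)
    (f_cvg : forall x : int, f_ n x @[n --> \oo] --> f x) :
  harmonic_int mu f.
Proof.
move=> x0; rewrite integral_atoms => [|x]; last by rewrite lee_fin.
have [C [Creal Cub]] := cvg_seq_bounded (cvgP _ (f_cvg x0)).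
have C1 n : f_ n x0 <= C + 1.
  have /Cub/(_ n) : C < C + 1 by rewrite ltrDl.
  by rewrite /= ger0_norm//; apply.
have lhs : (f_ n x0)%:E @[n --> \oo] --> (f x0)%:E.
  by apply: cvg_EFin; [exact: nearW|exact: f_cvg].
have rhs : (\int[mu]_(x in atoms mu) (f_ n (x0 + x))%:E)%E @[n --> \oo] -->
    (\int[mu]_(x in atoms mu) (f (x0 + x))%:E)%E.
  apply: (@dominated_cvg _ _ _ mu _ _ _ _
    (fun x => (C + 1)%:E * (growth mu x)%:E)%E) => //.
  - by move=> x _; apply: cvg_EFin; [exact: nearW|exact: f_cvg].
  - by apply: integrableZl => //; exact: integrable_growth.
  - move=> n x ax /=; rewrite ger0_norm// -EFinM lee_fin.
    have Hf : harmonic_ge0 mu (f_ n) by split.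
    apply: le_trans (harmonic_step_le _ Hf ax) _.
    by rewrite mulrC ler_wpM2r// ltW// growth_gt0.
apply: (cvg_unique _ lhs); first exact: ereal_hausdorff.
apply: cvg_trans rhs; apply: near_eq_cvg; apply: nearW => n.
by rewrite f_harmonic integral_atoms// => x; rewrite lee_fin.
Qed.
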